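(* Let $H$ be a marked graph of rank $n$, and let $\gamma$ be a collection of circuits in $H$ representing a partial free basis $C$ of $F_n$. Then $\gamma$ satisfies one of the following two conditions: - (Near Visibility Condition) for each vertex $v\in H$, each component of the Whitehead graph $W_v\gamma$ is a single edge; - (Cut Vertex Condition) for some vertex $v\in H$, some component of the Whitehead graph $W_v\gamma$ has a cut vertex.
   Context: A graph is a 1-dimensional CW complex. A core graph is a finite (here connected) graph with no vertex of valence 1; its rank is the rank of its fundamental group. $R_n$ is the rose with one vertex $v_0$ and $n$ oriented edges $e_1,\dots,e_n$; $F_n=\langle s_1,\dots,s_n\rangle$ is the free group of rank $n\ge 2$, identified with $\pi_1(R_n,v_0)$ via $s_i\leftrightarrow [e_i]$. A marked graph of rank $n$ is a rank $n$ core graph $H$ with a marking, i.e. a homotopy equivalence $\rho\colon R_n\to H$. Via $\rho$, conjugacy classes of $F_n$ correspond to free homotopy classes of maps $S^1\to H$. A circuit in $H$ is a locally injective continuous map $S^1\to H$, up to precomposition by orientation preserving homeomorphisms of $S^1$; each nontrivial conjugacy class of $F_n$ is represented by a unique circuit. A partial free basis is a subset of a free basis of $F_n$. A collection of circuits $\gamma\colon \Sigma\to H$ ($\Sigma$ a finite disjoint union of oriented circles) represents the partial free basis $C$ if the components of $\gamma$ are exactly the circuits representing the conjugacy classes of the elements of $C$, one component for each element. For a vertex $v\in H$, $T_vH$ denotes the set of directions at $v$, i.e. the set of germs at $v$ of oriented edges with initial vertex $v$ (a loop edge at $v$ contributes two directions). The Whitehead graph $W_v\gamma$ is the simplicial graph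 whose vertices are those directions in $T_vH$ represented by oriented edges $E$ (with initial vertex $v$) that are crossed by $\gamma$, and in which two distinct directions, represented by oriented edges $E\ne E'$ with initial vertex $v$, are joined by an edge if and only if $\overline E E'$ or $\overline{E'}E$ is a subpath of $\gamma$ (where $\overline E$ is the reversal of $E$). A vertex $w$ of a finite connected simplicial graph $W$ is a cut vertex if the topological space $W-\{w\}$ is disconnected. *)

(* Defs.v *)
From HB Require Import structures.
From mathcomp Require Import all_boot.

Set Implicit Arguments.
Unset Strict Implicit.
Unset Printing Implicit Defensive.

Local Open Scope group_scope.

(* A finite 1-dimensional CW complex in Serre's encoding: [edge] is the type of
   ORIENTED edges, so each 1-cell contributes the two elements d and bar d.
   Loops and multiple edges are allowed. *)
Record graph := Graph {
  vertex : finType;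
  edge : finType;
  ini : edge -> vertex;
  bar : edge -> edge;
  barK : involutive bar;
  bar_neq : forall d, bar d != d }.

Arguments ini {g} d.
Arguments bar {g} d.

Definition ter (H : graph) (d : edge H) : vertex H := ini (bar d).

(* [walk v p w]: the edge path p goes from v to w.  The empty sequence is the
   trivial path at any vertex. *)
Fixpoint walk (H : graph) (v : vertex H) (p : seq (edge H)) (w : vertex H) :=
  if p is d :: p' then (ini d == v) && walk (ter d) p' w else v == w.

Definition rev_path (H : graph) (p : seq (edge H)) : seq (edge H) :=
  rev (map bar p).

(* Homotopy of edge paths relative to their endpoints. *)
Inductive path_homotopic (H : graph) : seq (edge H) -> seq (edge H) -> Prop :=
| path_homotopic_refl p : path_homotopic p p
| path_homotopic_sym p q : path_homotopic p q -> path_homotopic q p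
| path_homotopic_trans p q r :
    path_homotopic p q -> path_homotopic q r -> path_homotopic p r
| path_homotopic_backtrack p d q :
    path_homotopic (p ++ d :: bar d :: q) (p ++ q).

Section Reduction.

Variable H : graph.
Implicit Types (d e : edge H) (p q r : seq (edge H)) (u v w : vertex H).

Definition reduced p : bool := sorted (fun d e => e != bar d) p.

Definition reduce_cons d p : seq (edge H) :=
  if p is e :: p' then if e == bar d then p' else d :: p else [:: d].

Definition reduce p : seq (edge H) := foldr reduce_cons [::] p.

Lemma barE d e : (e == bar d) = (d == bar e).
Proof. by apply/eqP/eqP => ->; rewrite barK. Qed.

Lemma reduced_tail d p : reduced (d :: p) -> reduced p.
Proof. exact: path_sorted. Qed.

Lemma reduce_cons_reduced d p : reduced p -> reduced (reduce_cons d p).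
Proof.
case: p => [//|e p]; rewrite /reduce_cons; case: ifP => [_|neq] red.
  exact: reduced_tail red.
by rewrite /reduced /= neq.
Qed.

Lemma reduce_reduced p : reduced (reduce p).
Proof. by elim: p => [//|d p IH]; apply: reduce_cons_reduced. Qed.

Lemma reduce_id p : reduced p -> reduce p = p.
Proof.
elim: p => [//|d p IH] red; rewrite /= (IH (reduced_tail red)).
by case: p red {IH} => [//|e p] /= /andP[/negbTE-> _].
Qed.

Lemma reduce_consK d p :
  reduced p -> reduce_cons d (reduce_cons (bar d) p) = p.
Proof.
case: p => [|e p] /=; first by rewrite eqxx.
rewrite barK; have [->|ne] := eqVneq e d; last by rewrite /= eqxx.
by case: p => [//|f p] /= /andP[/negbTE-> _].
Qed.

Lemma reduce_consKV d p :
  reduced p -> reduce_cons (bar d) (reduce_cons d p) = p.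
Proof. by move=> red; rewrite -{2}(barK d) reduce_consK. Qed.

Lemma reduce_catr p q : reduce (p ++ reduce q) = reduce (p ++ q).
Proof.
elim: p => [|d p IH] /=; last by rewrite IH.
by rewrite reduce_id ?reduce_reduced.
Qed.

Lemma reduce_cons_cat d p q :
  reduced p -> reduce (reduce_cons d p ++ q) = reduce_cons d (reduce (p ++ q)).
Proof.
case: p => [//|e p] red /=; case: eqP => [->|//] /=.
by rewrite reduce_consK ?reduce_reduced.
Qed.

Lemma reduce_catl p q : reduce (reduce p ++ q) = reduce (p ++ q).
Proof.
elim: p => [//|d p IH] /=.
by rewrite reduce_cons_cat ?reduce_reduced // IH.
Qed.

Lemma path_homotopicP p q : path_homotopic p q <-> reduce p = reduce q.
Proof.
split; first elim=> // {p q} [p q r _ -> _ ->//|p d q].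
  by rewrite -reduce_catr /= reduce_consK ?reduce_reduced // reduce_catr.
have red r : path_homotopic r (reduce r).
  elim: r => [|d r IH]; first exact: path_homotopic_refl.
  have cons s t : path_homotopic s t -> path_homotopic (d :: s) (d :: t).
    elim=> {s t} [s|s t _|s t u _ + _|s e t].
    - exact: path_homotopic_refl.
    - exact: path_homotopic_sym.
    - exact: path_homotopic_trans.
    - exact: (path_homotopic_backtrack (d :: s)).
  apply: path_homotopic_trans (cons _ _ IH) _ => /=.
  case: (reduce r) => [|e s] /=; first exact: path_homotopic_refl.
  case: eqP => [->|_]; last exact: path_homotopic_refl.
  exact: (path_homotopic_backtrack [::]).
move=> eq_pq; apply: path_homotopic_trans (red p) _; rewrite eq_pq.
exact: path_homotopic_sym.
Qed.

Lemma walk_cat p q u v w : walk u p v -> walk v q w -> walk u (p ++ q) w.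
Proof.
elim: p u => [|d p IH] u /=; first by move/eqP->.
by case/andP=> -> /= /IH; apply.
Qed.

Lemma walk_reduce p v w : walk v p w -> walk v (reduce p) w.
Proof.
elim: p v => [//|d p IH] v /= /andP[dv /IH].
case: (reduce p) => [|e q] /=; first by rewrite dv.
case: (e =P bar d) => [->|_] /=; last by rewrite dv.
by rewrite /ter barK (eqP dv) => /andP[].
Qed.

Lemma walk_rev p v w : walk v p w -> walk w (rev_path p) v.
Proof.
elim: p v => [|d p IH] v /=; first by rewrite /rev_path /= eq_sym.
case/andP=> /eqP<- /IH wk; rewrite /rev_path /= rev_cons -cats1.
by apply: walk_cat wk _; rewrite /= /ter barK !eqxx.
Qed.

Lemma rev_pathK : involutive (@rev_path H).
Proof. by move=> p; rewrite /rev_path map_rev revK mapK //; apply: barK. Qed.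

Lemma reduced_rev p : reduced p -> reduced (rev_path p).
Proof.
rewrite /reduced /rev_path rev_sorted sorted_map.
by apply: sub_sorted => d e /=; rewrite barK eq_sym.
Qed.

Lemma reduce_rev_catl p : reduce (rev_path p ++ p) = [::].
Proof.
elim: p => [//|d p IH]; rewrite /rev_path /= rev_cons -cats1 -catA -reduce_catr.
by rewrite /= reduce_consKV ?reduce_reduced // reduce_catr.
Qed.

Lemma reduce_rev_catr p : reduce (p ++ rev_path p) = [::].
Proof. by rewrite -{1}(rev_pathK p) reduce_rev_catl. Qed.

End Reduction.

(* The fundamental group: each homotopy class of loops at v is represented by
   its unique reduced loop.  The product x * y traverses x first. *)
Record pi1 (H : graph) (v : vertex H) := Pi1 {
  loop :> seq (edge H);
  _ : reduced loop && walk v loop v }.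

HB.instance Definition _ (H : graph) (v : vertex H) :=
  [isSub of pi1 v for @loop H v].
HB.instance Definition _ (H : graph) (v : vertex H) :=
  [Choice of pi1 v by <:].

Section Pi1Group.

Variables (H : graph) (v : vertex H).
Implicit Types x y z : pi1 v.

Lemma loop_reduced x : reduced x. Proof. by case/andP: (valP x). Qed.
Lemma loop_walk x : walk v x v. Proof. by case/andP: (valP x). Qed.

Lemma pi1_of_subproof p :
  walk v p v -> reduced (reduce p) && walk v (reduce p) v.
Proof. by move=> wp; rewrite reduce_reduced walk_reduce. Qed.

Definition pi1_of p (wp : walk v p v) : pi1 v := Pi1 (pi1_of_subproof wp).

Definition pi1_one : pi1 v := pi1_of (p := [::]) (eqxx v).
Definition pi1_mul x y : pi1 v :=
  pi1_of (walk_cat (loop_walk x) (loop_walk y)).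
Definition pi1_inv x : pi1 v := pi1_of (walk_rev (loop_walk x)).

Lemma pi1_mulA : associative pi1_mul.
Proof.
by move=> x y z; apply: val_inj; rewrite /= reduce_catr reduce_catl catA.
Qed.
Lemma pi1_mul1 : left_id pi1_one pi1_mul.
Proof. by move=> x; apply: val_inj; rewrite /= reduce_id ?loop_reduced. Qed.
Lemma pi1_mulr1 : right_id pi1_one pi1_mul.
Proof.
by move=> x; apply: val_inj; rewrite /= cats0 reduce_id ?loop_reduced.
Qed.
Lemma pi1_mulV : left_inverse pi1_one pi1_inv pi1_mul.
Proof.
by move=> x; apply: val_inj; rewrite /= reduce_catl reduce_rev_catl.
Qed.
Lemma pi1_mulrV : right_inverse pi1_one pi1_inv pi1_mul.
Proof.
by move=> x; apply: val_inj; rewrite /= reduce_catr reduce_rev_catr.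
Qed.

HB.instance Definition _ := isGroup.Build (pi1 v)
  pi1_mulA pi1_mul1 pi1_mulr1 pi1_mulV pi1_mulrV.

End Pi1Group.

(* Subsets of a possibly infinite group are predicates; K ranges over all
   groups, and only the values of f on B matter. *)
Definition free_basis (G : groupType) (B : G -> Prop) : Prop :=
  forall (K : groupType) (f : G -> K),
    (exists phi : {multiplicative G -> K}, forall x, B x -> phi x = f x) /\
    (forall phi psi : {multiplicative G -> K},
       (forall x, B x -> phi x = psi x) -> phi =1 psi).

Definition partial_free_basis (G : groupType) (C : G -> Prop) : Prop :=
  exists2 B : G -> Prop, free_basis B & forall x, C x -> B x.

Definition free_of_rank (G : groupType) (n : nat) : Prop :=
  exists2 b : 'I_n -> G, injective b & free_basis (fun x => exists i, b i = x).

Section Rose.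

Variable n : nat.

(* (i, false) is e_i and (i, true) is its reversal. *)
Definition rose_bar (d : 'I_n * bool) : 'I_n * bool := (d.1, ~~ d.2).

Lemma rose_barK : involutive rose_bar.
Proof. by case=> i b; rewrite /rose_bar /= negbK. Qed.

Lemma rose_bar_neq d : rose_bar d != d.
Proof. by case: d => i []; rewrite /rose_bar xpair_eqE eqxx. Qed.

Definition rose : graph := Graph (fun=> tt) rose_barK rose_bar_neq.

Definition rose_vertex : vertex rose := tt.

(* The free group of rank n is taken to be pi_1(R_n, v_0): its elements are the
   reduced words in the letters e_i and their inverses. *)
Definition free_group : groupType := pi1 rose_vertex.

Lemma walk_rose (u w : vertex rose) p : walk u p w.
Proof. by case: u w => [] []; elim: p. Qed.

Definition generator (i : 'I_n) : free_group :=
  pi1_of (walk_rose rose_vertex rose_vertex [:: (i, false)]).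

Lemma generator_inj : injective generator.
Proof. by move=> i j /(congr1 val)[]. Qed.

Lemma generator_free_basis :
  free_basis (fun x : free_group => exists i, generator i = x).
Proof.
move=> K f.
pose letter (d : edge rose) : K :=
  if d.2 then (f (generator d.1))^-1 else f (generator d.1).
have letter_bar d : letter (bar d) = (letter d)^-1.
  by case: d => i []; rewrite /letter /= ?invgK.
pose ev (p : seq (edge rose)) : K := foldr (fun d k => letter d * k) 1 p.
have ev_cat p q : ev (p ++ q) = ev p * ev q.
  by elim: p => [|d p IH] /=; rewrite ?mul1g // IH mulgA.
have ev_reduce p : ev (reduce p) = ev p.
  elim: p => [//|d p /= <-]; case: (reduce p) => [//|e q] /=.
  by case: eqP => [->|//]; rewrite letter_bar mulVKg.
split.
- have evM : {morph (fun x : free_group => ev (val x)) : x y / x * y}.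
    by move=> x y; rewrite /= ev_reduce ev_cat.
  pose M := isMultiplicative.Build free_group K _ evM.
  pose phi : {multiplicative free_group -> K} :=
    HB.pack (fun x : free_group => ev (val x)) M.
  by exists phi => _ [i <-]; rewrite /= mulg1.
- move=> phi psi eq_gen.
  have morph1 (h : {multiplicative free_group -> K}) : h 1 = 1.
    by apply: (mulgI (h 1)); rewrite -gmulfM !mulg1.
  have morphV (h : {multiplicative free_group -> K}) x : h x^-1 = (h x)^-1.
    by apply: (mulgI (h x)); rewrite -gmulfM !mulgV morph1.
  pose w p : free_group := pi1_of (walk_rose rose_vertex rose_vertex p).
  have eq_letter d : phi (w [:: d]) = psi (w [:: d]).
    case: d => i [].
      have -> : w [:: (i, true)] = (generator i)^-1 by apply: val_inj.
      by rewrite !morphV; congr (_ ^-1); apply: eq_gen; exists i.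
    have -> : w [:: (i, false)] = generator i by apply: val_inj.
    by apply: eq_gen; exists i.
  have eq_w p : phi (w p) = psi (w p).
    elim: p => [|d p IH].
      have -> : w [::] = 1 by apply: val_inj.
      by rewrite !morph1.
    have -> : w (d :: p) = w [:: d] * w p.
      by apply: val_inj; rewrite /= (reduce_id (reduce_reduced p)).
    by rewrite !gmulfM eq_letter IH.
  move=> x; have -> // : x = w (val x).
  by apply: val_inj; rewrite /= reduce_id ?loop_reduced.
Qed.

End Rose.

(* Up to homotopy, every continuous map of graphs is of this form. *)
Record graph_map (G H : graph) := GraphMap {
  on_vertex : vertex G -> vertex H;
  on_edge : edge G -> seq (edge H);
  on_edge_walk : forall d,
    walk (on_vertex (ini d)) (on_edge d) (on_vertex (ter d));
  on_edge_bar : forall d, on_edge (bar d) = rev_path (on_edge d) }.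

Definition on_path (G H : graph) (f : graph_map G H) (p : seq (edge G)) :
  seq (edge H) := flatten (map (on_edge f) p).

Lemma on_path_walk (G H : graph) (f : graph_map G H) p u v :
  walk u p v -> walk (on_vertex f u) (on_path f p) (on_vertex f v).
Proof.
elim: p u => [|d p IH] u /=; first by move/eqP->.
by case/andP=> /eqP<- /IH; apply: walk_cat; apply: on_edge_walk.
Qed.

Lemma on_path_rev (G H : graph) (f : graph_map G H) p :
  on_path f (rev_path p) = rev_path (on_path f p).
Proof.
elim: p => [//|d p IH]; rewrite /rev_path /= rev_cons -cats1.
rewrite /on_path map_cat flatten_cat /= cats0 on_edge_bar.
by rewrite -/(on_path f _) IH -rev_cat -map_cat.
Qed.

Lemma id_map_walk (G : graph) (d : edge G) : walk (ini d) [:: d] (ter d).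
Proof. by rewrite /= !eqxx. Qed.

Definition id_map (G : graph) : graph_map G G :=
  @GraphMap G G id (fun d => [:: d]) (@id_map_walk G) (fun=> erefl).

Section Composition.

Variables (G H K : graph) (g : graph_map H K) (f : graph_map G H).

Lemma comp_map_walk d :
  walk (on_vertex g (on_vertex f (ini d))) (on_path g (on_edge f d))
       (on_vertex g (on_vertex f (ter d))).
Proof. exact/on_path_walk/on_edge_walk. Qed.

Lemma comp_map_bar d :
  on_path g (on_edge f (bar d)) = rev_path (on_path g (on_edge f d)).
Proof. by rewrite on_edge_bar on_path_rev. Qed.

Definition comp_map : graph_map G K :=
  @GraphMap G K (on_vertex g \o on_vertex f) (on_path g \o on_edge f)
    comp_map_walk comp_map_bar.

End Composition.

(* [track u] is the path followed by the image of the vertex u during the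
   homotopy; such a homotopy extends over an edge d exactly when the two paths
   around the resulting square are homotopic. *)
Definition map_homotopic (G H : graph) (f g : graph_map G H) : Prop :=
  exists track : vertex G -> seq (edge H),
    (forall u, walk (on_vertex f u) (track u) (on_vertex g u)) /\
    (forall d, path_homotopic (on_edge f d ++ track (ter d))
                              (track (ini d) ++ on_edge g d)).

Definition homotopy_equivalence (G H : graph) (f : graph_map G H) : Prop :=
  exists g : graph_map H G,
    map_homotopic (comp_map g f) (id_map G) /\
    map_homotopic (comp_map f g) (id_map H).

Definition connected_graph (H : graph) : Prop :=
  0 < #|vertex H| /\ forall v w : vertex H, exists p, walk v p w.

Definition valence (H : graph) (v : vertex H) : nat :=
  #|[set d : edge H | ini d == v]|.

Definition core_graph (H : graph) : Prop :=
  connected_graph H /\ forall v : vertex H, valence v != 1%N.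

Definition graph_rank (H : graph) (n : nat) : Prop :=
  forall v : vertex H, free_of_rank (pi1 v) n.

Record marked_graph (n : nat) := MarkedGraph {
  mgraph :> graph;
  mgraph_core : core_graph mgraph;
  mgraph_rank : graph_rank mgraph n;
  marking : graph_map (rose n) mgraph;
  marking_equiv : homotopy_equivalence marking }.

(* A locally injective map S^1 -> H is, up to reparametrization, a nonempty
   cyclically reduced closed edge path; the choice of starting point on S^1
   makes the sequence well defined only up to rotation, and everything below is
   invariant under rotation. *)
Record circuit (H : graph) := Circuit {
  cpath :> seq (edge H);
  cpath_neq0 : cpath != [::];
  cpath_cycle :
    cycle (fun d e => (ter d == ini e) && (e != bar d)) cpath }.

(* The circuit c is freely homotopic to the image of x under the marking; h is
   the path followed by the base point during the free homotopy. *)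
Definition represents_class (n : nat) (H : marked_graph n) (c : circuit H)
    (x : free_group n) : Prop :=
  exists (v : vertex H) (h : seq (edge H)),
    [/\ walk v c v,
        walk v h (on_vertex (marking H) (rose_vertex n)) &
        path_homotopic (c ++ h) (h ++ on_path (marking H) (loop x))].

(* gamma has one component for each k : I. *)
Definition represents (n : nat) (H : marked_graph n) (I : finType)
    (gamma : I -> circuit H) (C : free_group n -> Prop) : Prop :=
  exists x : I -> free_group n,
    [/\ injective x,
        forall y, C y <-> exists k, x k = y &
        forall k, represents_class (gamma k) (x k)].

Record simple_graph (T : finType) := SimpleGraph {
  sg_vertices : {set T};
  sg_adj : rel T;
  sg_adj_sym : symmetric sg_adj;
  sg_adj_irr : irreflexive sg_adj;
  sg_adj_vertices : forall x y, sg_adj x y -> x \in sg_vertices }.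

Section SimpleGraph.

Variables (T : finType) (W : simple_graph T).

Definition components : {set {set T}} :=
  [set [set y in sg_vertices W | connect (sg_adj W) x y]
     | x in sg_vertices W].

Definition is_single_edge (A : {set T}) : Prop :=
  exists x y, sg_adj W x y /\ A = [set x; y].

(* A is the vertex set of a component of W.  Deleting the point w from that
   component leaves the half-open edges at w attached to their other endpoint,
   so what is left is connected iff the subgraph induced on A :\ w is. *)
Definition is_cut_vertex (A : {set T}) (w : T) : Prop :=
  w \in A /\
  exists x y, [/\ x \in A :\ w, y \in A :\ w &
    ~~ connect [rel a b | [&& sg_adj W a b, a \in A :\ w & b \in A :\ w]] x y].

End SimpleGraph.

Section Whitehead.

Variables (H : graph) (I : finType) (gamma : I -> circuit H).

(* Crossed in either direction. *)
Definition crossed (d : edge H) : bool :=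
  [exists k, (d \in cpath (gamma k)) || (bar d \in cpath (gamma k))].

(* The two-edge path d e is a subpath of some component of gamma; zipping with
   the rotation lists the cyclically consecutive pairs, including the pair
   (last edge, first edge). *)
Definition turn_taken (d e : edge H) : bool :=
  [exists k, (d, e) \in zip (gamma k) (rot 1 (gamma k))].

Definition whitehead_vertices (v : vertex H) : {set edge H} :=
  [set d | (ini d == v) && crossed d].

Definition whitehead_adj (v : vertex H) : rel (edge H) := fun d e =>
  [&& ini d == v, ini e == v, d != e &
      turn_taken (bar d) e || turn_taken (bar e) d].

Lemma whitehead_adj_sym v : symmetric (whitehead_adj v).
Proof. by move=> d e; rewrite /whitehead_adj andbCA (eq_sym d) orbC. Qed.

Lemma whitehead_adj_irr v : irreflexive (whitehead_adj v).
Proof. by move=> d; rewrite /whitehead_adj eqxx !andbF. Qed.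

Lemma turn_takenP d e : turn_taken d e ->
  exists k, d \in cpath (gamma k) /\ e \in cpath (gamma k).
Proof.
case/existsP=> k de; exists k.
have := map_f snd de; have := map_f fst de.
rewrite -/unzip1 -/unzip2 unzip1_zip ?unzip2_zip ?size_rot //.
by rewrite mem_rot.
Qed.

Lemma whitehead_adj_vertices v d e :
  whitehead_adj v d e -> d \in whitehead_vertices v.
Proof.
case/and4P=> dv _ _ tt; rewrite inE dv /=; apply/existsP.
by case/orP: tt => /turn_takenP[k [c1 c2]]; exists k; rewrite ?c1 ?c2 ?orbT.
Qed.

(* A direction at v is identified with the oriented edge issuing from v. *)
Definition whitehead_graph (v : vertex H) : simple_graph (edge H) :=
  SimpleGraph (whitehead_adj_sym v) (whitehead_adj_irr v)
    (@whitehead_adj_vertices v).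

Definition near_visibility : Prop :=
  forall v : vertex H, forall A, A \in components (whitehead_graph v) ->
    is_single_edge (whitehead_graph v) A.

Definition cut_vertex_condition : Prop :=
  exists (v : vertex H) (A : {set edge H}),
    A \in components (whitehead_graph v) /\
    exists w, is_cut_vertex (whitehead_graph v) A w.

End Whitehead.

(* Main.v *)
(* Map a wedge of lollipops, one for each element of a finite generating part
   of the basis, to H so that the petal belonging to an element of C runs along
   its circuit.  This map is an isomorphism on fundamental groups, so Stallings
   folds turn it into an embedding.  A fold merges the end points of two edges
   and glues the Whitehead graphs there at a single direction, which becomes a
   cut vertex if both edges are crossed by the circuits.  Read backwards from H:
   if no Whitehead graph in H has a cut vertex, then no fold identifies two
   crossed edges, hence the Whitehead graphs of H have the components they have
   on the disjoint petals, namely single edges. *)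

From HB Require Import structures.
From mathcomp Require Import all_boot boolp.
Require Import Defs.

Set Implicit Arguments.
Unset Strict Implicit.
Unset Printing Implicit Defensive.

Local Open Scope group_scope.

(** * Generation by a free basis *)

Definition is_subgroup (G : groupType) (S : G -> Prop) : Prop :=
  [/\ S 1, forall x y, S x -> S y -> S (x * y) & forall x, S x -> S x^-1].

(* The homomorphism onto the subgroup that fixes B, composed with the inclusion,
   is the identity by uniqueness. *)
Lemma free_basis_generates (G : groupType) (B S : G -> Prop) :
  free_basis B -> is_subgroup S -> (forall x, B x -> S x) -> forall x, S x.
Proof.
move=> hB [S1 SM SV] BS.
pose P : {pred G} := fun x => `[< S x >].
have P_closed : group_closed P.
  split=> [|x y /asboolP Sx /asboolP Sy]; apply/asboolP => //.
  exact/SM/SV.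
pose T := {x : G | P x}.
pose M := SubChoice_isSubGroup.Build G P T P_closed.
pose K : groupType := HB.pack T M.
(* Off [S] the value 1 is a filler: [phi] is compared with [f] only on [B]. *)
pose f x : K := if pselect (S x) is left Sx then Sub x (asboolT Sx) else 1.
have [[phi phiB] _] := hB K f.
have valM' : {morph (fun y : K => sval y) : x y / x * y} by [].
have cM : {morph (fun x : G => sval (phi x)) : x y / x * y}.
  by move=> x y; rewrite gmulfM valM'.
pose C := isMultiplicative.Build G G _ cM.
pose psi : {multiplicative G -> G} := HB.pack (fun x : G => sval (phi x)) C.
pose I := isMultiplicative.Build G G (fun x => x) (fun x y => erefl).
pose idG : {multiplicative G -> G} := HB.pack (fun x : G => x) I.
have eq_id : psi =1 idG.
  apply: (hB G (fun x => x)).2 => x Bx; rewrite /= phiB // /f.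
  by case: pselect => // nS; case: nS; apply: BS.
by move=> x; rewrite -[x]/(idG x) -eq_id; apply/asboolP/(svalP (phi x)).
Qed.

(* Each element of the finite basis involves only finitely many elements of B. *)
Lemma free_basis_finite_generation (G : groupType) (T : finType) (b : T -> G)
    (B : G -> Prop) :
  free_basis (fun x => exists i, b i = x) -> free_basis B ->
  exists l : seq G, (forall x, x \in l -> B x) /\
    forall S, is_subgroup S -> (forall x, x \in l -> S x) -> forall x, S x.
Proof.
move=> hb hB.
pose fg x := exists l : seq G, (forall y, y \in l -> B y) /\
    forall S, is_subgroup S -> (forall y, y \in l -> S y) -> S x.
have fg_sub : is_subgroup fg.
  split=> [|x y [l [lB lS]] [l' [lB' lS']]|x [l [lB lS]]].
  - by exists [::]; split=> // S [].
  - exists (l ++ l'); split=> [z|S hS Sl].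
      by rewrite mem_cat => /orP[/lB|/lB'].
    case: (hS) => _ SM _; apply: SM; [apply: lS|apply: lS'] => // z zl;
    by apply: Sl; rewrite mem_cat zl ?orbT.
  - by exists l; split=> // S hS Sl; case: (hS) => _ _; apply; apply: lS.
have fgB : forall x, fg x.
  apply: (free_basis_generates hB) => // x Bx.
  exists [:: x]; split=> [y|S _]; first by rewrite inE => /eqP->.
  by apply; rewrite inE.
have [l hl] := fin_all_exists (fun i => fgB (b i)).
exists (flatten [seq l i | i <- enum T]); split=> [x|S hS Sl].
  by move=> /flatten_mapP[i _]; case: (hl i) => + _; apply.
apply: (free_basis_generates hb) => // _ [i <-].
case: (hl i) => _; apply=> // y yl; apply: Sl.
by apply/flatten_mapP; exists i; rewrite ?mem_enum.
Qed.

(** * Path classes and simplicial maps *)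

Section PathClasses.

Variable H : graph.
Implicit Types (d : edge H) (p q : seq (edge H)).

(* Identifying all vertices makes every edge sequence a loop, so that homotopy
   classes of arbitrary edge sequences form a group. *)
Definition flat : graph :=
  @Graph unit (edge H) (fun=> tt) bar (@barK H) (@bar_neq H).

Lemma walk_flat p : walk (H := flat) tt p tt.
Proof. by elim: p => //= d p ->. Qed.

Definition path_group : groupType := pi1 (H := flat) tt.

Definition cls p : path_group := pi1_of (walk_flat p).

Lemma clsE p q : cls p = cls q <-> reduce p = reduce q.
Proof. by split=> [/(congr1 val)|eq_pq]; [|apply: val_inj]. Qed.

Lemma cls_nil : cls [::] = 1.
Proof. exact: val_inj. Qed.

Lemma cls_cat p q : cls (p ++ q) = cls p * cls q.
Proof.
by apply: val_inj; rewrite /= (@reduce_catr flat) (@reduce_catl flat).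
Qed.

Lemma cls_cons d p : cls (d :: p) = cls [:: d] * cls p.
Proof. by rewrite -cls_cat. Qed.

Lemma cls_rev p : cls (rev_path p) = (cls p)^-1.
Proof.
apply/(mulIg (cls p)); rewrite mulVg -cls_cat -cls_nil; apply/clsE.
by rewrite reduce_rev_catl.
Qed.

Lemma cls_bar d : cls [:: bar d] = (cls [:: d])^-1.
Proof. by rewrite -cls_rev. Qed.

Lemma cls_homotopic p q : path_homotopic p q -> cls p = cls q.
Proof. by move=> pq; apply/clsE/path_homotopicP. Qed.

End PathClasses.

Lemma on_path_cat (G H : graph) (f : graph_map G H) p q :
  on_path f (p ++ q) = on_path f p ++ on_path f q.
Proof. by rewrite /on_path map_cat flatten_cat. Qed.

(** The image of a backtrack [d], [bar d] is a path followed by its reversal, which cancels. *)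
Lemma cls_on_path_reduce (G H : graph) (f : graph_map G H) p :
  cls (on_path f (reduce p)) = cls (on_path f p).
Proof.
elim: p => [//|d p IH]; rewrite /= -[d :: p]/([:: d] ++ p) on_path_cat cls_cat.
rewrite -{}IH -cls_cat -on_path_cat; case: (reduce p) => [//|e q] /=.
case: eqP => [->|//]; rewrite /on_path /= on_edge_bar.
by rewrite !cls_cat cls_rev mulVKg.
Qed.

Lemma cls_on_path (G H : graph) (f : graph_map G H) p q :
  cls p = cls q -> cls (on_path f p) = cls (on_path f q).
Proof.
by move=> /clsE pq; rewrite -cls_on_path_reduce pq cls_on_path_reduce.
Qed.

Lemma on_path_comp (G H K : graph) (g : graph_map H K) (f : graph_map G H) p :
  on_path (comp_map g f) p = on_path g (on_path f p).
Proof.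
elim: p => [//|d p IH]; rewrite -[d :: p]/([:: d] ++ p) !on_path_cat IH.
by rewrite /on_path /= !cats0.
Qed.

Lemma on_path_id (G : graph) p : on_path (id_map G) p = p.
Proof. by elim: p => [//|d p] /= {2}<-. Qed.

(** The squares of successive edges are pasted along the tracks of their common vertices. *)
Lemma homotopic_on_path (G H : graph) (f g : graph_map G H) track :
  (forall d, path_homotopic (on_edge f d ++ track (ter d))
                            (track (ini d) ++ on_edge g d)) ->
  forall p u v, walk u p v ->
  cls (on_path f p) * cls (track v) = cls (track u) * cls (on_path g p).
Proof.
move=> sq p u v; elim: p u => [|d p IH] u /=.
  by move/eqP->; rewrite !cls_nil mul1g mulg1.
case/andP=> /eqP<- /IH eq_p; rewrite /on_path /= !cls_cat -mulgA eq_p !mulgA.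
by congr (_ * _); rewrite -!cls_cat (cls_homotopic (sq d)).
Qed.

(** Unlike in [graph_map], edges go to single edges, as folding requires. *)
Record simplicial_map (G H : graph) := SimplicialMap {
  sv : vertex G -> vertex H;
  se :> edge G -> edge H;
  se_ini : forall d, ini (se d) = sv (ini d);
  se_bar : forall d, se (bar d) = bar (se d) }.

Section SimplicialMap.

Variables (G H : graph) (f : simplicial_map G H).
Implicit Types (d e : edge G) (p q : seq (edge G)) (u v : vertex G).

Lemma se_ter d : ter (f d) = sv f (ter d).
Proof. by rewrite /ter -se_bar se_ini. Qed.

Lemma walk_map u p v : walk u p v -> walk (sv f u) (map f p) (sv f v).
Proof.
elim: p u => [|d p IH] u /=; first by move/eqP->.
by case/andP=> /eqP<- /IH; rewrite se_ini se_ter eqxx.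
Qed.

Lemma map_rev_path p : map f (rev_path p) = rev_path (map f p).
Proof.
rewrite /rev_path map_rev -!map_comp; congr rev.
by apply: eq_map => d /=; rewrite se_bar.
Qed.

Lemma map_reduce p : reduce (map f (reduce p)) = reduce (map f p).
Proof.
elim: p => [//|d p IH] /=; rewrite -IH; case: (reduce p) => [//|e q] /=.
case: eqP => [->|//]; rewrite /= se_bar.
by rewrite reduce_consK ?reduce_reduced.
Qed.

Lemma cls_map p q : cls p = cls q -> cls (map f p) = cls (map f q).
Proof. by move/clsE=> pq; apply/clsE; rewrite -map_reduce pq map_reduce. Qed.

Definition immersion : Prop :=
  forall d e, ini d = ini e -> f d = f e -> d = e.

(** A backtrack in the image of consecutive edges [d], [e] would give [e] and [bar d] the same image
    and the same initial vertex, hence make them equal. *)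
Lemma immersion_reduced u p v :
  immersion -> walk u p v -> reduced p -> reduced (map f p).
Proof.
move=> imm; elim: p u => [//|d [//|e p] IH] u /andP[_ wk] red.
have /andP[ne redp] : (e != bar d) && reduced (e :: p) by [].
have /andP[e_d _] := wk.
apply/andP; split; last exact: IH wk redp.
rewrite -se_bar; apply: contra ne => /eqP fe.
by rewrite (imm e (bar d)) ?(eqP e_d).
Qed.

End SimplicialMap.

(** * Whitehead graphs along a simplicial map *)

Section Turns.

Variables (I : finType).

Definition path_turn (T : eqType) (g : I -> seq T) (d e : T) : Prop :=
  exists k, (d, e) \in zip (g k) (rot 1 (g k)).

Definition used (G : graph) (g : I -> seq (edge G)) (d : edge G) : Prop :=
  exists k, (d \in g k) || (bar d \in g k).

Lemma used_bar (G : graph) (g : I -> seq (edge G)) d :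
  used g d -> used g (bar d).
Proof. by case=> k dk; exists k; rewrite barK orbC. Qed.

Section PathTurn.

Variables (T : eqType) (g : I -> seq T).

Lemma zip_rot_mem (s : seq T) d e :
  (d, e) \in zip s (rot 1 s) -> d \in s /\ e \in s.
Proof.
move=> de; have := map_f snd de; have := map_f fst de.
by rewrite -/unzip1 -/unzip2 unzip1_zip ?unzip2_zip ?size_rot // mem_rot.
Qed.

Lemma path_turn_next k d : d \in g k -> exists e, path_turn g d e.
Proof.
move=> dk; have : d \in unzip1 (zip (g k) (rot 1 (g k))).
  by rewrite unzip1_zip ?size_rot.
by case/mapP=> [[d' e] de /= ->]; exists e, k.
Qed.

Lemma path_turn_prev k d : d \in g k -> exists e, path_turn g e d.
Proof.
move=> dk; have : d \in unzip2 (zip (g k) (rot 1 (g k))).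
  by rewrite unzip2_zip ?size_rot // mem_rot.
by case/mapP=> [[e d'] de /= ->]; exists e, k.
Qed.

Lemma path_turn_map (T' : eqType) (f : T -> T') d' e' :
  path_turn (fun k => map f (g k)) d' e' <->
  exists d e, [/\ path_turn g d e, f d = d' & f e = e'].
Proof.
have zipE s : zip (map f s) (rot 1 (map f s)) =
    map (fun x => (f x.1, f x.2)) (zip s (rot 1 s)).
  rewrite -map_rot; elim: s (rot 1 s) => [|x s IH] [|y t] //=.
  by rewrite IH.
split=> [[k]|[d [e [[k de] <- <-]]]].
  by rewrite zipE => /mapP[[d e] de [-> ->]]; exists d, e; split=> //; exists k.
by exists k; rewrite zipE; apply/mapP; exists (d, e).
Qed.

Lemma cycle_zip_rot (r : rel T) s d e :
  cycle r s -> (d, e) \in zip s (rot 1 s) -> r d e.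
Proof.
(* The closing point of the cycle becomes [y], independent of the running head [x], to allow
   induction on [p]. *)
case: s => [//|x p]; rewrite rot1_cons /=; move: {2 4}x => y.
elim: p x => [|z p IH] x /=; first by rewrite andbT inE => rxy /eqP[-> ->].
by case/andP=> rxz /IH h; rewrite inE => /orP[/eqP[-> ->]|/h].
Qed.

End PathTurn.

Lemma turn_takenE (H : graph) (gamma : I -> circuit H) d e :
  turn_taken gamma d e <-> path_turn gamma d e.
Proof. by split=> [/existsP|[k de]] //; apply/existsP; exists k. Qed.

Lemma turn_taken_ini (H : graph) (gamma : I -> circuit H) d e :
  path_turn gamma d e -> ter d = ini e /\ e != bar d.
Proof.
by case=> k; move/(cycle_zip_rot (cpath_cycle (gamma k))) => /andP[/eqP].
Qed.

Lemma whitehead_adj_turn (H : graph) (gamma : I -> circuit H) d e :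
  path_turn gamma (bar d) e -> whitehead_adj gamma (ini d) d e.
Proof.
move=> de; have [de_ini ne] := turn_taken_ini de.
rewrite /whitehead_adj -de_ini /ter barK !eqxx /=.
rewrite barK eq_sym in ne; rewrite ne /=.
by have -> : turn_taken gamma (bar d) e by apply/turn_takenE.
Qed.

End Turns.

(* A partially folded graph G over H, in which the circuits lift to closed paths
   g.  The last two conditions express injectivity and surjectivity on
   fundamental groups. *)
Record folding_stage (H : graph) (I : finType) (gamma : I -> circuit H)
    (G : graph) (f : simplicial_map G H) (g : I -> seq (edge G)) : Prop := {
  stage_map : forall k, map f (g k) = gamma k;
  stage_turn : forall d e, path_turn g d e -> ter d = ini e;
  stage_inj : forall x p, walk x p x -> cls (map f p) = 1 -> cls p = 1;
  stage_surj : forall d e, f d = f e ->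
    exists p, walk (ini d) p (ini e) /\ cls (map f p) = 1 }.

Section Stage.

Variables (H : graph) (I : finType) (gamma : I -> circuit H).
Variables (G : graph) (f : simplicial_map G H) (g : I -> seq (edge G)).
Hypothesis st : folding_stage gamma f g.

Lemma stage_path_turn D E :
  path_turn gamma D E <->
  exists d e, [/\ path_turn g d e, f d = D & f e = E].
Proof.
rewrite -path_turn_map; split=> -[k DE]; exists k;
  by rewrite /= ?(stage_map st) // in DE *.
Qed.

(** A path with trivial image from [ini d] to [ini e] may be taken reduced; an immersion keeps it
    reduced, so it is empty and [d], [e] start at one vertex. *)
Lemma stage_immersion_inj : immersion f -> injective f.
Proof.
move=> imm d e de; apply: (imm) => //.
have [p [/walk_reduce wp fp]] := stage_surj st de.
have redp := immersion_reduced imm wp (reduce_reduced p).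
have : reduce (map f (reduce p)) = [::].
  by apply/(clsE _ [::]); rewrite cls_nil -fp; apply/clsE; rewrite map_reduce.
rewrite (reduce_id redp); case: (reduce p) wp => //= /eqP //.
Qed.

End Stage.

(** * Whitehead adjacency lifted to a folding stage *)

Section Adjacency.

Variables (I : finType) (G : graph) (g : I -> seq (edge G)).

Definition adjacent (d e : edge G) : Prop :=
  path_turn g (bar d) e \/ path_turn g (bar e) d.

Lemma adjacent_sym d e : adjacent d e -> adjacent e d.
Proof. by case; [right|left]. Qed.

Lemma adjacent_used d e : adjacent d e -> used g e.
Proof.
case=> -[k /zip_rot_mem[m1 m2]]; exists k; first by rewrite m2.
by rewrite m1 orbT.
Qed.

Lemma used_adjacent d : used g d -> exists e, adjacent d e.
Proof.
case=> k /orP[/path_turn_prev|/path_turn_next] [e de]; last by exists e; left.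
by exists (bar e); right; rewrite barK.
Qed.

Variables (H : graph) (gamma : I -> circuit H) (f : simplicial_map G H).
Hypothesis st : folding_stage gamma f g.

Lemma adjacent_ini d e : adjacent d e -> ini d = ini e.
Proof. by case=> /(stage_turn st); rewrite /ter barK. Qed.

(** The turns of [gamma] are exactly the images of the turns of the lifts; the two directions of an
    adjacent pair stay distinct in [H] because circuits are reduced. *)
Lemma whitehead_adjP v D E : whitehead_adj gamma v D E <->
  exists d e, [/\ adjacent d e, f d = D, f e = E & ini D = v].
Proof.
split=> [/and4P[/eqP Dv _ _ /orP[]/turn_takenE/(stage_path_turn st)]|].
- move=> [d [e [de dD eE]]]; exists (bar d), e; split=> //.
    by left; rewrite barK.
  by rewrite se_bar dD barK.
- move=> [e [d [de eE dD]]]; exists d, (bar e); split=> //.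
    by right; rewrite barK.
  by rewrite se_bar eE barK.
case=> d [e [de <- <- <-]].
have fde : ini (f d) = ini (f e) by rewrite !se_ini (adjacent_ini de).
case: de => [de|de]; last rewrite whitehead_adj_sym fde;
  by apply: whitehead_adj_turn; apply/(stage_path_turn st);
    rewrite -se_bar; do 2!eexists; split; [exact: de|..].
Qed.

Lemma crossed_used D : crossed gamma D -> exists2 d, used g d & f d = D.
Proof.
case/existsP=> k; rewrite -(stage_map st) => /orP[]/mapP[d dk].
  by move=> ->; exists d => //; exists k; rewrite dk.
move=> Dd; exists (bar d); last by rewrite se_bar -Dd barK.
by exists k; rewrite barK dk orbT.
Qed.

End Adjacency.

(** * Folding *)

Section Fold.

Variables (G : graph) (e1 e2 : edge G).
Hypotheses (e12_ini : ini e1 = ini e2) (e12_ter : ter e1 != ter e2).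

Let e1_neq : e1 != e2.
Proof. by apply: contra e12_ter => /eqP->. Qed.

Let e1_neq_bar : e1 != bar e2.
Proof.
apply: contra e12_ter => /eqP e12.
by rewrite {1}e12 /ter barK -e12_ini e12.
Qed.

Definition fold_vertex (x : vertex G) := if x == ter e2 then ter e1 else x.

Definition fold_rep (d : edge G) :=
  if d == e2 then e1 else if d == bar e2 then bar e1 else d.

Definition kept (d : edge G) := (d != e2) && (d != bar e2).

Lemma kept_bar d : kept d -> kept (bar d).
Proof.
rewrite /kept (inj_eq (can_inj (@barK G))) (eq_sym (bar d)) (barE d e2).
by rewrite andbC.
Qed.

Lemma kept_fold_rep d : kept (fold_rep d).
Proof.
have k1 : kept e1 by rewrite /kept e1_neq.
rewrite /fold_rep; case: eqP => // /eqP d1; case: eqP => [_|/eqP d2].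
  exact: kept_bar.
by rewrite /kept d1.
Qed.

Definition folded_edge : finType := {d : edge G | kept d}.

Definition folded_bar (d : folded_edge) : folded_edge :=
  Sub (bar (val d)) (kept_bar (valP d)).

Lemma folded_barK : involutive folded_bar.
Proof. by move=> d; apply: val_inj; rewrite /= barK. Qed.

Lemma folded_bar_neq d : folded_bar d != d.
Proof. by rewrite -val_eqE /= bar_neq. Qed.

(* The vertex [ter e2] is left behind as an isolated vertex. *)
Definition fold_graph : graph :=
  @Graph (vertex G) folded_edge (fun d => fold_vertex (ini (val d)))
    folded_bar folded_barK folded_bar_neq.

Definition fold_edge (d : edge G) : edge fold_graph :=
  Sub (fold_rep d) (kept_fold_rep d).

Lemma fold_vertex_ter : fold_vertex (ter e1) = fold_vertex (ter e2).
Proof. by rewrite /fold_vertex eqxx if_same. Qed.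

Lemma fold_edge_ini d : ini (fold_edge d) = fold_vertex (ini d).
Proof.
rewrite /= /fold_rep; case: eqP => [->|_]; first by rewrite e12_ini.
by case: eqP => [->|//]; apply: fold_vertex_ter.
Qed.

Lemma fold_edge_bar d : fold_edge (bar d) = bar (fold_edge d).
Proof.
apply: val_inj; rewrite /= /fold_rep (inj_eq (can_inj (@barK G))).
rewrite (eq_sym (bar d)) (barE d e2); case: (d =P e2) => [->|_].
  by rewrite eq_sym (negPf (bar_neq _)).
by case: ifP; rewrite ?barK.
Qed.

Definition fold_map : simplicial_map G fold_graph :=
  SimplicialMap fold_edge_ini fold_edge_bar.

Lemma fold_edge_val (d : edge fold_graph) : fold_edge (val d) = d.
Proof.
by apply: val_inj; case/andP: (valP d) => /= /negPf d1 /negPf d2;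
  rewrite /fold_rep d1 d2.
Qed.

Lemma fold_edge_eq d d' : fold_edge d = fold_edge d' ->
  [\/ d = d', d = e1 /\ d' = e2 \/ d = e2 /\ d' = e1
    | d = bar e1 /\ d' = bar e2 \/ d = bar e2 /\ d' = bar e1].
Proof.
have binj := can_inj (@barK G).
move/(congr1 val); rewrite /= /fold_rep.
case: (d =P e2) => [->|n1]; last case: (d =P bar e2) => [->|n2].
all: case: (d' =P e2) => [->|m1]; last case: (d' =P bar e2) => [->|m2] //.
all: move=> E; try by [constructor 1 | constructor 2; auto | constructor 3; auto].
all: try by constructor 1; apply: binj.
- by move: (bar_neq e1); rewrite -E eqxx.
- by move: (bar_neq e1); rewrite E eqxx.
Qed.

(** The decreasing measure for the induction on folds: [e2] disappears. *)
Lemma card_fold : #|edge fold_graph| < #|edge G|.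
Proof.
rewrite card_sig; apply/proper_card/properP; split; first exact/subsetP.
by exists e2; rewrite // inE /kept eqxx.
Qed.

(** * Lifting maps and paths through a fold *)

Section FoldLift.

Variables (H : graph) (f : simplicial_map G H).
Hypothesis f_e12 : f e1 = f e2.

Lemma fold_lift_vertex x : sv f (fold_vertex x) = sv f x.
Proof.
by rewrite /fold_vertex; case: eqP => [->|//]; rewrite -!se_ter f_e12.
Qed.

Lemma fold_lift_ini (d : edge fold_graph) : ini (f (val d)) = sv f (ini d).
Proof. by rewrite /= fold_lift_vertex se_ini. Qed.

Lemma fold_lift_bar (d : edge fold_graph) : f (val (bar d)) = bar (f (val d)).
Proof. by rewrite /= se_bar. Qed.

Definition fold_lift : simplicial_map fold_graph H :=
  SimplicialMap fold_lift_ini fold_lift_bar.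

Lemma fold_liftE d : fold_lift (fold_edge d) = f d.
Proof.
rewrite /= /fold_rep; case: eqP => [->//|_]; case: eqP => [->|//].
by rewrite !se_bar f_e12.
Qed.

Lemma map_fold_lift p : map fold_lift (map fold_edge p) = map f p.
Proof. by rewrite -map_comp; apply: eq_map => d; apply: fold_liftE. Qed.

(** The path [bar e1], [e2] joins the two identified vertices, and both [f] and the fold turn it
    into a backtrack. *)
Lemma fold_connector x y : fold_vertex x = fold_vertex y ->
  exists p, [/\ walk x p y, cls (map f p) = 1 & cls (map fold_edge p) = 1].
Proof.
pose s := [:: bar e1; e2].
have ws : walk (ter e1) s (ter e2) by rewrite /= /ter !barK e12_ini !eqxx.
have fs : cls (map f s) = 1.
  by rewrite /= cls_cons se_bar cls_bar f_e12 mulVg.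
have es : cls (map fold_edge s) = 1.
  rewrite /= cls_cons fold_edge_bar cls_bar.
  have -> : fold_edge e1 = fold_edge e2.
    apply: val_inj; rewrite /= /fold_rep eqxx.
    by rewrite (negPf e1_neq) (negPf e1_neq_bar).
  by rewrite mulVg.
rewrite /fold_vertex; case: (x =P ter e2) => [->|_];
  case: (y =P ter e2) => [->|_].
- by exists [::]; rewrite /= !cls_nil eqxx.
- move=> <-; exists (rev_path s); split; first exact: walk_rev ws.
    by rewrite map_rev_path cls_rev fs invg1.
  by rewrite (map_rev_path fold_map) cls_rev es invg1.
- by move=> ->; exists s.
- by move=> ->; exists [::]; rewrite /= !cls_nil eqxx.
Qed.

(** Read in [G], a path of the folded graph may jump between [ter e1] and [ter e2]; connectors
    bridge the gaps. *)
Lemma fold_path_lift (p' : seq (edge fold_graph)) x y :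
  walk (H := fold_graph) (fold_vertex x) p' (fold_vertex y) ->
  exists p, [/\ walk x p y, cls (map f p) = cls (map fold_lift p')
              & cls (map fold_edge p) = cls p'].
Proof.
elim: p' x => [|d p' IH] x /=.
  by move/eqP/fold_connector=> [p]; rewrite !cls_nil; exists p.
case/andP=> /eqP/esym/fold_connector[c [wc fc ec]] /IH[p [wp fp ep]].
exists (c ++ val d :: p); split.
- by apply: walk_cat wc _; rewrite /= eqxx.
- rewrite map_cat cls_cat fc mul1g /= cls_cons fp.
  by rewrite [RHS]cls_cons.
- rewrite map_cat cls_cat ec mul1g /= cls_cons ep fold_edge_val.
  by rewrite [RHS]cls_cons.
Qed.

Lemma fold_stage (I : finType) (gamma : I -> circuit H) g :
  folding_stage gamma f g ->
  folding_stage gamma fold_lift (fun k => map fold_edge (g k)).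
Proof.
case=> g_map g_turn f_inj f_surj; split.
- by move=> k; rewrite map_fold_lift.
- move=> d' e' /path_turn_map[d [e [/g_turn de <- <-]]].
  by rewrite (se_ter fold_map) (se_ini fold_map) de.
(* A nonempty loop starts at a vertex in the image of [fold_vertex]; the empty one may sit at the
   abandoned [ter e2]. *)
- move=> x [|d' p'] wp fp; first exact: cls_nil.
  have xE : x = fold_vertex (ini (val d')) by case/andP: wp => /eqP<-.
  rewrite xE in wp; have [p [wp' fp' <-]] := fold_path_lift wp.
  rewrite -fp' in fp; have := f_inj _ _ wp' fp.
  by rewrite -cls_nil => /(cls_map fold_map); rewrite /= cls_nil.
- move=> d e de; have [p [wp fp]] := f_surj _ _ de.
  exists (map fold_edge p); rewrite map_fold_lift; split=> //.
  exact: (walk_map fold_map wp).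
Qed.

End FoldLift.

End Fold.

(* Folding two used edges merges the Whitehead graphs at their end points along
   a single vertex.  The directions coming from [ter e2] other than [bar e2]
   are then separated from those coming from [ter e1], and no further
   identification of used directions destroys this. *)
Lemma fold_cut_vertex (H : graph) (I : finType) (gamma : I -> circuit H)
    (G : graph) (f : simplicial_map G H) g (e1 e2 : edge G) :
  folding_stage gamma f g ->
  ini e1 = ini e2 -> ter e1 != ter e2 -> f e1 = f e2 ->
  used g e1 -> used g e2 ->
  (forall d e, used g d -> used g e -> f d = f e ->
    [\/ d = e, d = e1 /\ e = e2 \/ d = e2 /\ e = e1
      | d = bar e1 /\ e = bar e2 \/ d = bar e2 /\ e = bar e1]) ->
  cut_vertex_condition gamma.
Proof.
move=> st e12_ini e12_ter f_e12 u1 u2 fib.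
have [d1 d1P] := used_adjacent (used_bar u1).
have [d2 d2P] := used_adjacent (used_bar u2).
(* [E] is the direction at which the two Whitehead graphs are glued, the common image of [bar e1]
   and [bar e2]. *)
pose E := bar (f e1); pose v := ini E.
have d1_ini : ini d1 = ter e1 by rewrite -(adjacent_ini st d1P).
have d2_ini : ini d2 = ter e2 by rewrite -(adjacent_ini st d2P).
have adj1 : whitehead_adj gamma v E (f d1).
  by apply/(whitehead_adjP st); exists (bar e1), d1; rewrite se_bar.
have adj2 : whitehead_adj gamma v E (f d2).
  by apply/(whitehead_adjP st); exists (bar e2), d2; rewrite se_bar -f_e12.
pose W := whitehead_graph gamma v.
exists v, [set y in sg_vertices W | connect (sg_adj W) E y]; split.
  by apply: imset_f; apply: whitehead_adj_vertices adj1.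
have inA d : whitehead_adj gamma v E d ->
    d \in [set y in sg_vertices W | connect (sg_adj W) E y] :\ E.
  move=> Ed; rewrite !inE (connect1 (e := sg_adj W) Ed) andbT.
  rewrite whitehead_adj_sym in Ed; apply/andP; split.
    by apply: contraTneq Ed => ->; rewrite whitehead_adj_irr.
  by have := whitehead_adj_vertices Ed; rewrite inE.
exists E; split.
  by rewrite inE connect0 andbT; apply: whitehead_adj_vertices adj1.
exists (f d2), (f d1); split; [exact: inA|exact: inA|].
(* [S] will contain [f d2], miss [f d1] and be closed under adjacency away from [E], so that [E]
   separates the two. *)
pose S D := exists d, [/\ used g d, ini d = ter e2, d <> bar e2 & f d = D].
have S2 : S (f d2).
  exists d2; split=> //; first exact: adjacent_used d2P.
  move=> d2E; rewrite {}d2E in adj2.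
  by rewrite se_bar -f_e12 -/E whitehead_adj_irr in adj2.
have S1 : ~ S (f d1).
  case=> d [ud d_ini d_ne fd].
  case: (fib _ _ ud (adjacent_used d1P) fd) => [dE|[]|[]].
  - by move: e12_ter; rewrite -d1_ini -dE d_ini eqxx.
  - by case=> dE d1E; move: e12_ter; rewrite -d1_ini -d_ini dE d1E e12_ini eqxx.
  - by case=> dE d1E; move: e12_ter; rewrite -d1_ini -d_ini dE d1E e12_ini eqxx.
  - by case=> dE _; case/eqP: e12_ter; rewrite -d_ini dE.
  - by case.
have S_step D D' : S D -> whitehead_adj gamma v D D' -> D' != E -> S D'.
  case=> d [ud d_ini d_ne fd].
  case/(whitehead_adjP st)=> [d0 [d0' [dd' d0D d0'D' _]]] D'E.
  (* The preimage [d0] of [D] in this adjacency need not be [d], but [fib] leaves only a swap of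
     [e1] and [e2], which start at one vertex. *)
  have d0_ini : ini d0 = ter e2.
    have := fib _ _ ud (adjacent_used (adjacent_sym dd')).
    rewrite fd d0D => /(_ erefl)[<-//|[[dE ->]|[dE ->]]|[[dE _]|[]//]].
    - by rewrite -e12_ini -d_ini dE.
    - by rewrite e12_ini -d_ini dE.
    - by case/eqP: e12_ter; rewrite -d_ini dE.
  exists d0'; split=> //; first exact: adjacent_used dd'.
    by rewrite -(adjacent_ini st dd').
  by move=> d0'E; move: D'E; rewrite -d0'D' d0'E se_bar -f_e12 eqxx.
apply/negP => /connectP[p]; move: S2 => /[swap].
elim: p (f d2) => [|D p IH] D0 /=.
  by move=> _ S2 E1; apply: S1; rewrite E1.
case/andP=> /and3P[D0D _ DA] pp SD0 lst.
by apply: (IH D) => //; apply: S_step SD0 D0D _; case/setD1P: DA.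
Qed.

(** Induction on the number of edges. After a fold, used edges inject by induction, so [f] can
    identify used edges only through [e1], [e2] or their reversals; were both used, there would be a
    cut vertex. *)
Lemma stage_used_inj (H : graph) (I : finType) (gamma : I -> circuit H)
    (G : graph) (f : simplicial_map G H) g :
  folding_stage gamma f g -> ~ cut_vertex_condition gamma ->
  forall d e, used g d -> used g e -> f d = f e -> d = e.
Proof.
move=> + nocut; have [N] := ubnP #|edge G|.
elim: N G f g => [//|N IH] G f g leN st.
case: (pselect (immersion f)) => [imm|].
  by move=> d e _ _; apply: (stage_immersion_inj st).
move=> /existsNP[e1] /existsNP[e2] /not_implyP[e12_ini] /not_implyP[f_e12 e12].
(* With equal end points, [e1] followed by [bar e2] would be a nontrivial loop with trivial
   image. *)
have e12_ter : ter e1 != ter e2.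
  apply/eqP => e12_ter; apply: e12.
  have : cls [:: e1; bar e2] = 1.
    apply: (stage_inj st (x := ini e1)).
      by rewrite /= e12_ter /ter barK e12_ini !eqxx.
    by rewrite /= cls_cons se_bar cls_bar f_e12 mulgV.
  rewrite cls_cons cls_bar -[1](mulgV (cls [:: e2])) => /mulIg.
  by move/clsE=> [].
have := IH _ _ _ _ (fold_stage e12_ini e12_ter f_e12 st).
rewrite (leq_trans (card_fold e1 e2)) // => /(_ isT) fold_inj.
have fib d e : used g d -> used g e -> f d = f e ->
    fold_edge e12_ini e12_ter d = fold_edge e12_ini e12_ter e.
  have u' x : used g x -> used (fun k => map (fold_edge e12_ini e12_ter) (g k))
      (fold_edge e12_ini e12_ter x).
    case=> k xk; exists k; rewrite -fold_edge_bar.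
    by apply/orP; case/orP: xk => xk; [left|right]; apply: map_f.
  by move=> ud ue de; apply: fold_inj; rewrite ?fold_liftE //; apply: u'.
have nused : ~ (used g e1 /\ used g e2).
  case=> u1 u2; apply: nocut.
  apply: (fold_cut_vertex st (e12_ini) (e12_ter) f_e12 u1 u2).
  by move=> d e ud ue de; apply: fold_edge_eq (fib _ _ ud ue de).
move=> d e ud ue de.
case: (fold_edge_eq (fib _ _ ud ue de)) => [//|[]|[]] [dE eE].
- by case: nused; rewrite -dE -eE.
- by case: nused; rewrite -dE -eE.
- by case: nused; move/used_bar: ud; move/used_bar: ue; rewrite dE eE !barK.
- by case: nused; move/used_bar: ud; move/used_bar: ue; rewrite dE eE !barK.
Qed.

(** * Near visibility from injectivity on used edges *)

Lemma uniq_fst_inj (S T : eqType) (z : seq (S * T)) x y y' :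
  uniq (unzip1 z) -> (x, y) \in z -> (x, y') \in z -> y = y'.
Proof.
elim: z => [//|[a b] z IH] /= /andP[az uz]; rewrite !inE.
have notin c : (a, c) \notin z by apply: contra az => /(map_f fst).
case/predU1P=> [[-> ->]|xy]; case/predU1P=> [[] //|xy'].
- by rewrite (negPf (notin _)) in xy'.
- by move=> xa _; rewrite xa (negPf (notin _)) in xy.
- exact: IH.
Qed.

(** The lifts cross each edge at most once and in one orientation only, so a used direction has
    exactly one neighbour; injectivity carries this over to [H]. *)
Lemma near_visibilityI (H : graph) (I : finType) (gamma : I -> circuit H)
    (G : graph) (f : simplicial_map G H) (g : I -> seq (edge G)) :
  folding_stage gamma f g ->
  (forall d e, used g d -> used g e -> f d = f e -> d = e) ->
  (forall k, uniq (g k)) ->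
  (forall k k' d, d \in g k -> d \in g k' -> k = k') ->
  (forall k k' d, d \in g k -> bar d \notin g k') ->
  near_visibility gamma.
Proof.
move=> st finj guniq gdisj gor.
have next_uniq d e e' : path_turn g d e -> path_turn g d e' -> e = e'.
  case=> k de [k' de'].
  have [dk _] := zip_rot_mem de; have [dk' _] := zip_rot_mem de'.
  rewrite -(gdisj _ _ _ dk dk') in de'; apply: uniq_fst_inj de de'.
  by rewrite unzip1_zip ?size_rot.
have prev_uniq d d' e : path_turn g d e -> path_turn g d' e -> d = d'.
  case=> k de [k' de'].
  have [_ ek] := zip_rot_mem de; have [_ ek'] := zip_rot_mem de'.
  rewrite -(gdisj _ _ _ ek ek') in de'.
  have swapz (s t : seq (edge G)) x y :
      (x, y) \in zip s t -> (y, x) \in zip t s.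
    by elim: s t => [|a s IH] [|b t] //=; rewrite !inE !xpair_eqE andbC =>
      /orP[->//|/IH->]; rewrite orbT.
  apply: uniq_fst_inj (swapz _ _ _ _ de) (swapz _ _ _ _ de').
  by rewrite unzip1_zip ?size_rot // rot_uniq.
have adj_uniq d e e' : adjacent g d e -> adjacent g d e' -> e = e'.
  (* Neighbours of [d] of both kinds would force the lifts to cross [d] in both orientations. *)
  have no_both x y : path_turn g (bar d) x -> path_turn g y d -> False.
    case=> k /zip_rot_mem[dk _] [k' /zip_rot_mem[_ dk']].
    by have := gor _ k _ dk'; rewrite dk.
  move=> [de|de] [de'|de'].
  - exact: next_uniq de de'.
  - by case: (no_both _ _ de de').
  - by case: (no_both _ _ de' de).
  - exact: (can_inj (@barK G)) (prev_uniq _ _ _ de de').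
have wh_uniq v D E E' :
    whitehead_adj gamma v D E -> whitehead_adj gamma v D E' -> E = E'.
  case/(whitehead_adjP st)=> d [e [de dD <- _]].
  case/(whitehead_adjP st)=> d' [e' [de' dD' <- _]].
  have dd' : d = d'.
    apply: finj; last by rewrite dD.
      exact: adjacent_used (adjacent_sym de).
    exact: adjacent_used (adjacent_sym de').
  by rewrite -dd' in de'; rewrite (adj_uniq _ _ _ de de').
move=> v A /imsetP[x xv ->].
move: (xv); rewrite inE => /andP[/eqP x_ini /(crossed_used st)[d ud dx]].
have [e de] := used_adjacent ud.
have xy : whitehead_adj gamma v x (f e).
  by apply/(whitehead_adjP st); exists d, e.
exists x, (f e); split=> //; apply/setP=> z; rewrite !inE.
apply/idP/idP=> [/andP[_ /connectP[p]]|].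
  (* A walk from [x] in the Whitehead graph can only alternate between [x] and [f e]. *)
  suff h a : (a == x) || (a == f e) ->
      path (sg_adj (whitehead_graph gamma v)) a p ->
      z = last a p -> (z == x) || (z == f e).
    by apply: h; rewrite eqxx.
  elim: p a => [a ha _ ->//|b p IH a ha /= /andP[ab pp]]; apply: IH => //.
  case/orP: ha => /eqP aE; rewrite aE in ab.
    by rewrite (wh_uniq _ _ _ _ ab xy) eqxx orbT.
  rewrite whitehead_adj_sym in xy.
  by rewrite (wh_uniq _ _ _ _ ab xy) eqxx.
case/orP=> /eqP->; first by move: xv; rewrite inE => ->; rewrite connect0.
rewrite (connect1 (e := sg_adj (whitehead_graph gamma v)) xy) andbT.
rewrite whitehead_adj_sym in xy.
by have := whitehead_adj_vertices xy; rewrite inE.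
Qed.

(** * Wedges of lollipops *)

Section PathEnd.

Variable H : graph.
Implicit Types (p q : seq (edge H)) (u v w : vertex H).

Definition path_end v p := last v (map (@ter H) p).

Lemma walk_end v p w : walk v p w -> path_end v p = w.
Proof.
elim: p v => [v /eqP//|d p IH] v /= /andP[_]; exact: IH.
Qed.

Lemma walk_nth d0 v p w i : walk v p w -> i < size p ->
  ini (nth d0 p i) = path_end v (take i p) /\
  ter (nth d0 p i) = path_end v (take i.+1 p).
Proof.
elim: p v i => [//|d p IH] v [|i] /= /andP[/eqP dv wp] lt_ip.
  by rewrite take0.
exact: IH wp lt_ip.
Qed.

Lemma walk_catr u p v q w : walk u p v -> walk u (p ++ q) w -> walk v q w.
Proof.
elim: p u => [|d p IH] u /=; first by move/eqP->.
by case/andP=> _ wp /andP[_]; apply: IH.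
Qed.

Lemma walk_cycle v p :
  walk v p v -> cycle (fun d e : edge H => ter d == ini e) p.
Proof.
case: p => [//|b p] /= /andP[/eqP b_ini].
elim: p {1 2}b => [|d p IH] c /=; first by rewrite b_ini andbT.
by case/andP=> /eqP-> /IH->; rewrite eqxx.
Qed.

End PathEnd.

Section Lollipops.

Variables (H : graph) (m : vertex H) (J : finType).
Variables (stick petal : J -> seq (edge H)) (top : J -> vertex H).
Hypothesis stick_walk : forall j, walk m (stick j) (top j).
Hypothesis petal_walk : forall j, walk (top j) (petal j) (top j).

Let q j := stick j ++ petal j.
Let a j := size (stick j).
Let M := \max_j size (q j).

Let a_le j : a j <= size (q j).
Proof. by rewrite size_cat leq_addr. Qed.

Let q_walk j : walk m (q j) (top j).
Proof. exact: walk_cat (stick_walk j) (petal_walk j). Qed.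

(** [None] is the wedge point. One bound [M] for all [j] keeps the type nondependent, at the cost of
    isolated vertices. *)
Definition lollipop_vertex : finType := option (J * 'I_M.+1).

(* [(Tagged _ i, false)] is the i-th edge of the j-th lollipop, the stick being
   traversed first; the boolean marks the reversed orientation. *)
Definition lollipop_edge : finType := ({j : J & 'I_(size (q j))} * bool)%type.

Definition position (j : J) (i : nat) : lollipop_vertex :=
  if i == 0 then None else Some (j, inord i).

(* The petal closes up at the end of the stick. *)
Definition wrap (j : J) (i : nat) := if i == size (q j) then a j else i.

Definition lollipop_ini (d : lollipop_edge) : lollipop_vertex :=
  let j := tag d.1 in let i : nat := tagged d.1 in
  position j (wrap j (if d.2 then i.+1 else i)).

Definition lollipop_bar (d : lollipop_edge) : lollipop_edge := (d.1, ~~ d.2).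

Lemma lollipop_barK : involutive lollipop_bar.
Proof. by case=> x b; rewrite /lollipop_bar /= negbK. Qed.

Lemma lollipop_bar_neq d : lollipop_bar d != d.
Proof. by case: d => x []; rewrite /lollipop_bar xpair_eqE eqxx. Qed.

Definition lollipops : graph :=
  @Graph lollipop_vertex lollipop_edge lollipop_ini lollipop_bar
    lollipop_barK lollipop_bar_neq.

Definition lollipop_base : vertex lollipops := None.

Definition lollipop_sv (x : vertex lollipops) : vertex H :=
  if x is Some (j, i) then path_end m (take i (q j)) else m.

Definition lollipop_se (d : edge lollipops) : edge H :=
  let l := tnth (in_tuple (q (tag d.1))) (tagged d.1) in
  if d.2 then bar l else l.

Lemma size_q_lt j i : i <= size (q j) -> i < M.+1.
Proof. by move=> le_i; apply: leq_trans le_i (leq_bigmax j). Qed.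

Lemma lollipop_sv_position j i :
  i <= size (q j) -> lollipop_sv (position j i) = path_end m (take i (q j)).
Proof.
rewrite /position; case: eqP => [->|_] le_i; first by rewrite take0.
by rewrite /= inordK ?(size_q_lt le_i).
Qed.

Lemma wrap_le j i : i <= size (q j) -> wrap j i <= size (q j).
Proof. by rewrite /wrap; case: ifP. Qed.

Lemma wrap_end j i :
  path_end m (take (wrap j i) (q j)) = path_end m (take i (q j)).
Proof.
rewrite /wrap; case: eqP => // ->; rewrite take_size (walk_end (q_walk j)).
by rewrite take_size_cat // (walk_end (stick_walk j)).
Qed.

Lemma lollipop_se_ini d : ini (lollipop_se d) = lollipop_sv (ini d).
Proof.
case: d => [[j i] b]; rewrite /= /lollipop_ini /lollipop_se /=.
have [wi wt] := walk_nth (tnth (in_tuple (q j)) i) (q_walk j) (ltn_ord i).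
rewrite (tnth_nth (tnth (in_tuple (q j)) i)) /=.
by case: b; rewrite lollipop_sv_position ?wrap_le ?wrap_end // ltnW.
Qed.

Lemma lollipop_se_bar d : lollipop_se (bar d) = bar (lollipop_se d).
Proof. by case: d => x []; rewrite /lollipop_se /= ?barK. Qed.

Definition lollipop_map : simplicial_map lollipops H :=
  SimplicialMap lollipop_se_ini lollipop_se_bar.

Definition lollipop_path j : seq (edge lollipops) :=
  [seq (Tagged (fun j => 'I_(size (q j))) i, false)
     | i <- enum 'I_(size (q j))].

Lemma size_lollipop_path j : size (lollipop_path j) = size (q j).
Proof. by rewrite size_map size_enum_ord. Qed.

Lemma map_lollipop_path j : map lollipop_map (lollipop_path j) = q j.
Proof.
rewrite /lollipop_path -map_comp.
exact: (map_tnth_enum (in_tuple (q j))).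
Qed.

Lemma nth_lollipop_path d0 j (i : 'I_(size (q j))) :
  nth d0 (lollipop_path j) i = (Tagged (fun j => 'I_(size (q j))) i, false).
Proof. by rewrite (nth_map i) ?size_enum_ord // nth_ord_enum. Qed.

Lemma wrap_stick j : wrap j (a j) = a j.
Proof. by rewrite /wrap if_same. Qed.

Lemma wrap_lt j i : i < size (q j) -> wrap j i = i.
Proof. by rewrite /wrap => lt_i; rewrite ltn_eqF. Qed.

Lemma walk_lollipop_path j i : i <= size (q j) ->
  walk lollipop_base (take i (lollipop_path j)) (position j (wrap j i)).
Proof.
elim: i => [|i IH] le_i.
  (* Position 0 is wrapped only if [q j] is empty, and then [a j] is 0 as well. *)
  rewrite take0 /wrap; case: eqP => // q0.
  by have := a_le j; rewrite -q0 leqn0 => /eqP->.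
pose d : edge lollipops :=
  (Tagged (fun j => 'I_(size (q j))) (Ordinal le_i), false).
rewrite (take_nth d) ?size_lollipop_path // -cats1.
apply: walk_cat (IH (ltnW le_i)) _.
by rewrite (nth_lollipop_path d (Ordinal le_i)) /= /lollipop_ini /ter /= !eqxx.
Qed.

Definition lollipop_petal j := drop (a j) (lollipop_path j).

Lemma walk_lollipop_petal j :
  walk (H := lollipops) (position j (a j)) (lollipop_petal j) (position j (a j)).
Proof.
have := walk_lollipop_path (leqnn (size (q j))).
rewrite -{1}(size_lollipop_path j) take_size /wrap eqxx.
rewrite -{1}(cat_take_drop (a j) (lollipop_path j)).
by apply: walk_catr; rewrite -{2}(wrap_stick j); apply: walk_lollipop_path.
Qed.

Lemma map_lollipop_petal j : map lollipop_map (lollipop_petal j) = petal j.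
Proof. by rewrite map_drop map_lollipop_path drop_size_cat. Qed.

Lemma lollipop_petal_uniq j : uniq (lollipop_petal j).
Proof.
apply: drop_uniq; rewrite map_inj_uniq ?enum_uniq // => i i' [].
by move/eqP; rewrite -tag_eqE /tag_eq /= eqxx tagged_asE => /eqP.
Qed.

Lemma lollipop_petal_mem j d :
  d \in lollipop_petal j -> tag d.1 = j /\ d.2 = false.
Proof. by move/mem_drop/mapP=> [i _ ->]. Qed.

(* The spanning tree consists of all edges except the last one of each petal. *)
Definition tree_path (x : vertex lollipops) : seq (edge lollipops) :=
  if x is Some (j, i) then take i (lollipop_path j) else [::].

Lemma tree_path_position j i :
  i <= size (q j) -> tree_path (position j i) = take i (lollipop_path j).
Proof.
rewrite /position; case: eqP => [->|_] le_i; first by rewrite take0.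
by rewrite /= inordK ?(size_q_lt le_i).
Qed.

(** Restricted to initial vertices of edges, since isolated vertices cannot be reached from the
    base. *)
Lemma walk_tree_path (d : edge lollipops) :
  walk lollipop_base (tree_path (ini d)) (ini d).
Proof.
case: d => [[j i] b]; rewrite /= /lollipop_ini /=.
set k := if b then _ else _.
have le_k : k <= size (q j) by rewrite /k; case: (b); rewrite // ltnW.
rewrite tree_path_position ?wrap_le //.
have wrapK : wrap j (wrap j k) = wrap j k.
  rewrite /wrap; case: (k =P size (q j)) => [_|/eqP/negPf->//].
  by rewrite if_same.
by rewrite -{2}wrapK; apply/walk_lollipop_path/wrap_le.
Qed.

Definition lollipop_loop j : seq (edge lollipops) :=
  lollipop_path j ++ rev_path (take (a j) (lollipop_path j)).

Lemma walk_lollipop_loop j : walk lollipop_base (lollipop_loop j) lollipop_base.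
Proof.
apply: (@walk_cat lollipops _ _ _ (position j (a j))); last first.
  by apply: walk_rev; rewrite -{2}(wrap_stick j); apply: walk_lollipop_path.
have := walk_lollipop_path (leqnn (size (q j))).
by rewrite -{1}(size_lollipop_path j) take_size /wrap eqxx.
Qed.

Lemma cls_map_lollipop_loop j : cls (map lollipop_map (lollipop_loop j)) =
  cls (stick j) * cls (petal j) * (cls (stick j))^-1.
Proof.
rewrite map_cat map_rev_path map_take map_lollipop_path take_size_cat //.
by rewrite !cls_cat cls_rev.
Qed.

(* The fundamental group of the lollipops is generated by [lollipop_loop]. *)
Lemma lollipop_hom_eq (Theta : seq (edge lollipops) -> path_group lollipops) :
  {morph Theta : p r / p ++ r >-> p * r} ->
  (forall p, Theta (rev_path p) = (Theta p)^-1) ->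
  (forall j, Theta (lollipop_loop j) = cls (lollipop_loop j)) ->
  forall x p, walk x p x -> Theta p = 1 -> cls p = 1.
Proof.
move=> ThM ThV Th_loop x p wp Thp.
have Th1 : Theta [::] = 1.
  by apply: (mulgI (Theta [::])); rewrite -ThM mulg1.
(* [ok d] says that [Theta] and [cls] agree on [d] once tree paths close it up to a loop. *)
pose ok d :=
  Theta (tree_path (ini d)) * Theta [:: d] * (Theta (tree_path (ter d)))^-1 =
  cls (tree_path (ini d)) * cls [:: d] * (cls (tree_path (ter d)))^-1.
have ok_fwd y : ok (y, false).
  case: y => j i; rewrite /ok /ter /= /lollipop_ini /= wrap_lt //.
  set d : edge lollipops := (_, false).
  rewrite !tree_path_position ?(ltnW (ltn_ord i)) ?wrap_le //.
  have Ed : take i (lollipop_path j) ++ [:: d] = take i.+1 (lollipop_path j).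
    by rewrite cats1 (take_nth d) ?size_lollipop_path // nth_lollipop_path.
  (* Tree edges give 1 on both sides; the last edge of [q j] gives [lollipop_loop j]. *)
  rewrite -ThM -cls_cat Ed /wrap; case: eqP => [iq|_]; last by rewrite !mulgV.
  rewrite iq -(size_lollipop_path j) take_size.
  by rewrite -ThV -cls_rev -ThM -cls_cat; apply: Th_loop.
have ok_all d : ok d.
  case: d => y []; last exact: ok_fwd.
  have := ok_fwd y; set d : edge lollipops := (y, false).
  rewrite -[(y, true)]/(bar d) /ok {2 4}/ter barK => /(congr1 (fun z => z^-1)).
  rewrite !invgM !invgK -!mulgA -/(ter d) cls_bar.
  by have := ThV [:: d]; rewrite /rev_path /= => ->.
have walk_ok y r z : walk y r z ->
    Theta (tree_path y) * Theta r * (Theta (tree_path z))^-1 =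
    cls (tree_path y) * cls r * (cls (tree_path z))^-1.
  elim: r y => [|d r IH] y /=.
    by move/eqP->; rewrite Th1 cls_nil !mulg1 !mulgV.
  case/andP=> /eqP<- /IH eq_r.
  rewrite (ThM [:: d] r) cls_cons.
  have step (K : groupType) (A B C D E : K) :
      A * (B * D) * E^-1 = (A * B * C^-1) * (C * D * E^-1).
    by rewrite !mulgA mulgVK.
  by rewrite (step _ _ _ (Theta (tree_path (ter d)))) eq_r ok_all -step.
have := walk_ok _ _ _ wp; rewrite Thp mulg1 mulgV => eq1.
apply: (mulgI (cls (tree_path x))); apply: (mulIg (cls (tree_path x))^-1).
by rewrite -eq1 mulg1 mulgV.
Qed.

Section LollipopStage.

Variables (I : finType) (gamma : I -> circuit H) (jj : I -> J).
Hypothesis petal_gamma : forall k, petal (jj k) = gamma k.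
Variable Theta : seq (edge lollipops) -> path_group lollipops.
Hypothesis ThM : {morph Theta : p r / p ++ r >-> p * r}.
Hypothesis ThV : forall p, Theta (rev_path p) = (Theta p)^-1.
Hypothesis Th_loop : forall j, Theta (lollipop_loop j) = cls (lollipop_loop j).
Hypothesis Th_trivial : forall p, cls (map lollipop_map p) = 1 -> Theta p = 1.
Hypothesis lollipop_surj : forall u, walk m u m ->
  exists r, walk lollipop_base r lollipop_base /\
            cls (map lollipop_map r) = cls u.

(** For injectivity, [Theta] kills loops with trivial image yet fixes the generating loops. For
    surjectivity, the images of two tree paths form a loop at [m], which lifts up to homotopy. *)
Lemma lollipop_stage :
  folding_stage gamma lollipop_map (fun k => lollipop_petal (jj k)).
Proof.
split.
- by move=> k; rewrite map_lollipop_petal petal_gamma.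
- move=> d e [k].
  by move/(cycle_zip_rot (walk_cycle (walk_lollipop_petal (jj k))))/eqP.
- move=> x p wp /Th_trivial; exact: (lollipop_hom_eq ThM ThV Th_loop wp).
- move=> d e de.
  have wd := walk_tree_path d; have we := walk_tree_path e.
  have wfd := walk_map lollipop_map wd; have wfe := walk_map lollipop_map we.
  rewrite -!se_ini -de in wfd wfe.
  have [r [wr fr]] := lollipop_surj (walk_cat wfd (walk_rev wfe)).
  exists (rev_path (tree_path (ini d)) ++ r ++ tree_path (ini e)); split.
    exact: walk_cat (walk_rev wd) (walk_cat wr we).
  rewrite !map_cat map_rev_path !cls_cat fr cls_cat !cls_rev.
  by rewrite -mulgA mulVg mulg1 mulVg.
Qed.

End LollipopStage.

End Lollipops.

(** * Marked graphs *)

Section Words.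

Variable n : nat.
Implicit Types p q : seq (edge (rose n)).

Definition word p : free_group n := pi1_of (walk_rose tt tt p).

Lemma wordM p q : word (p ++ q) = word p * word q.
Proof. by apply: val_inj; rewrite /= reduce_catr reduce_catl. Qed.

Lemma word_cls p q : cls p = cls q -> word p = word q.
Proof. by move/clsE=> pq; apply: val_inj. Qed.

Lemma word_nil : word [::] = 1.
Proof. exact: val_inj. Qed.

Lemma word_rev p : word (rev_path p) = (word p)^-1.
Proof.
apply: (mulIg (word p)); rewrite mulVg -wordM -word_nil.
by apply: word_cls; rewrite cls_cat cls_rev mulVg cls_nil.
Qed.

Lemma word_loop (x : free_group n) : word (loop x) = x.
Proof. by apply: val_inj; rewrite /= reduce_id ?loop_reduced. Qed.

End Words.

Lemma multiplicative1 (G K : groupType) (phi : {multiplicative G -> K}) :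
  phi 1 = 1.
Proof. by apply: (mulgI (phi 1)); rewrite -gmulfM !mulg1. Qed.

Lemma multiplicativeV (G K : groupType) (phi : {multiplicative G -> K}) x :
  phi x^-1 = (phi x)^-1.
Proof. by apply: (mulgI (phi x)); rewrite -gmulfM !mulgV multiplicative1. Qed.

Section Marking.

Variables (n : nat) (H : marked_graph n).

Let rho := marking H.
Let m : vertex H := on_vertex rho (rose_vertex n).

(** As the rose has one vertex, a homotopy inverse of the marking assigns a group element to every
    edge sequence, closed or not. Conjugation by the track of the base point makes it a left
    inverse. *)
Lemma marking_retraction : exists theta : seq (edge H) -> free_group n,
  [/\ {morph theta : p q / p ++ q >-> p * q},
      forall p, theta (rev_path p) = (theta p)^-1,
      forall p q, cls p = cls q -> theta p = theta q &
      forall x, theta (on_path rho (loop x)) = x].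
Proof.
have [g [[t [_ t_sq]] _]] := marking_equiv H.
pose T := word (t tt).
exists (fun p => T^-1 * word (on_path g p) * T); split.
- by move=> p q; rewrite on_path_cat wordM !mulgA mulgK.
- by move=> p; rewrite on_path_rev word_rev !invgM invgK mulgA.
- by move=> p q /(cls_on_path g)/word_cls->.
move=> x; have := homotopic_on_path t_sq (loop_walk x).
rewrite on_path_id on_path_comp -!cls_cat => /word_cls.
by rewrite !wordM word_loop -mulgA => ->; rewrite mulKg.
Qed.

Lemma marking_surj u : walk m u m ->
  exists x : free_group n, cls (on_path rho (loop x)) = cls u.
Proof.
have [g [_ [s [s_walk s_sq]]]] := marking_equiv H => wu.
have ws : walk m (s m) m.
  have := s_walk m; rewrite /=; suff -> : on_vertex g m = rose_vertex n by [].
  by case: (on_vertex g m).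
(* Conjugation by [s m] compensates in advance for the motion of the base point in the homotopy from
   [rho] after [g] to the identity. *)
pose w := rev_path (s m) ++ u ++ s m.
have ww : walk m w m := walk_cat (walk_rev ws) (walk_cat wu ws).
exists (word (on_path g w)); rewrite /= cls_on_path_reduce.
apply: (mulIg (cls (s m))); rewrite -on_path_comp.
rewrite (homotopic_on_path s_sq ww) on_path_id /w !cls_cat cls_rev.
by rewrite mulVKg.
Qed.

(** The reversed track of the free homotopy serves as stick, the circuit as petal. *)
Lemma represents_class_lollipop (c : circuit H) (x : free_group n) :
  represents_class c x -> exists h v,
    [/\ walk m h v, walk v c v &
        cls h * cls c * (cls h)^-1 = cls (on_path rho (loop x))].
Proof.
case=> v [h [wc wh /cls_homotopic]]; rewrite !cls_cat => ch.
exists (rev_path h), v; split=> //; first exact: walk_rev.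
by rewrite cls_rev invgK -mulgA ch mulKg.
Qed.

End Marking.

Theorem proposition2p5p2 (n : nat) (hn : 2 <= n) (H : marked_graph n)
    (I : finType) (gamma : I -> circuit H) (C : free_group n -> Prop)
    (hC : partial_free_basis C) (hgamma : represents gamma C) :
  near_visibility gamma \/ cut_vertex_condition gamma.
Proof.
case: hC => B hB CB; case: hgamma => x [xinj Cx xrep].
case: (pselect (cut_vertex_condition gamma)) => [|nocut]; [by right|left].
pose rho := marking H; pose m : vertex H := on_vertex rho (rose_vertex n).
have [theta [thM thV th_cls thK]] := marking_retraction H.
have [l [lB lgen]] := free_basis_finite_generation (@generator_free_basis n) hB.
(* [l] generates the free group; the elements of [C] are added so that each has a lollipop. *)
pose s := l ++ codom x; pose J : finType := seq_sub s.
have sB (j : J) : B (val j).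
  have := valP j; rewrite mem_cat => /orP[/lB//|/codomP[k ->]].
  by apply/CB/Cx; exists k.
have xs k : x k \in s by rewrite mem_cat codom_f orbT.
pose jj k : J := SeqSub (xs k).
have jj_inj : injective jj by move=> k k' /(congr1 val)/xinj.
have lollipopP (j : J) : exists t : seq (edge H) * seq (edge H) * vertex H,
    [/\ walk m t.1.1 t.2, walk t.2 t.1.2 t.2,
      cls t.1.1 * cls t.1.2 * (cls t.1.1)^-1 = cls (on_path rho (loop (val j)))
      & forall k, jj k = j -> t.1.2 = gamma k].
  (* An element of [C] gets its circuit as petal; any other gets an empty stick and its image loop
     at [m]. *)
  case: (pselect (exists k, jj k = j)) => [[k <-]|no_k].
    have [h [v [wh wc hc]]] := represents_class_lollipop (xrep k).
    by exists (h, cpath (gamma k), v); split=> // k' /jj_inj->.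
  exists ([::], on_path rho (loop (val j)), m); split=> /=.
  - exact: eqxx.
  - by apply: on_path_walk; apply: loop_walk.
  - by rewrite cls_nil invg1 mul1g mulg1.
  - by move=> k kj; case: no_k; exists k.
have [lp lpP] := fin_all_exists lollipopP.
pose stick j := (lp j).1.1; pose petal j := (lp j).1.2; pose top j := (lp j).2.
have wstick j : walk m (stick j) (top j) by case: (lpP j).
have wpetal j : walk (top j) (petal j) (top j) by case: (lpP j).
have loop_cls j :
    cls (map (lollipop_map wstick wpetal) (lollipop_loop stick petal j)) =
    cls (on_path rho (loop (val j))).
  by rewrite cls_map_lollipop_loop; case: (lpP j).
have petal_gamma k : petal (jj k) = gamma k.
  by case: (lpP (jj k)) => _ _ _; apply.
(* Freeness of [B] extends this to a homomorphism [phi]; elements outside [s] go to 1. *)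
pose loop_of (y : free_group n) : path_group (lollipops stick petal) :=
  if insub y is Some j then cls (lollipop_loop stick petal (j : J)) else 1.
have [[phi phiB] _] := hB _ loop_of.
(* [Theta] undoes the lollipop map on loops at the base: [theta] returns to the free group, [phi] to
   the lollipops. *)
pose Theta p := phi (theta (map (lollipop_map wstick wpetal) p)).
have st : folding_stage gamma (lollipop_map wstick wpetal)
    (fun k => lollipop_petal stick petal (jj k)).
  apply: (lollipop_stage petal_gamma (Theta := Theta)).
  - by move=> p q; rewrite /Theta map_cat thM gmulfM.
  - by move=> p; rewrite /Theta map_rev_path thV multiplicativeV.
  - move=> j; rewrite /Theta (th_cls _ _ (loop_cls j)) thK phiB // /loop_of.
    by rewrite valK.
  - move=> p p1; rewrite /Theta (th_cls _ [::]) ?cls_nil //.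
    have -> : theta [::] = 1 by apply: (mulgI (theta [::])); rewrite -thM mulg1.
    exact: multiplicative1.
  move=> u /marking_surj[y <-].
  (* The elements realized by loops of the lollipops form a subgroup containing [l], hence are all
     of the free group. *)
  pose S (z : free_group n) := exists r,
    walk (lollipop_base stick petal) r (lollipop_base stick petal) /\
    cls (map (lollipop_map wstick wpetal) r) = cls (on_path rho (loop z)).
  have clsM y1 y2 : cls (on_path rho (loop (y1 * y2 : free_group n))) =
      cls (on_path rho (loop y1)) * cls (on_path rho (loop y2)).
    by rewrite /= cls_on_path_reduce on_path_cat cls_cat.
  have clsV y1 : cls (on_path rho (loop (y1^-1 : free_group n))) =
      (cls (on_path rho (loop y1)))^-1.
    by rewrite /= cls_on_path_reduce on_path_rev cls_rev.
  apply: (lgen S); first split.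
  - by exists [::]; rewrite /= !cls_nil.
  - move=> y1 y2 [r1 [w1 f1]] [r2 [w2 f2]]; exists (r1 ++ r2).
    by rewrite clsM map_cat cls_cat f1 f2 (walk_cat w1 w2).
  - move=> y1 [r1 [w1 f1]]; exists (rev_path r1).
    by rewrite clsV map_rev_path cls_rev f1 (walk_rev w1).
  - move=> y1 y1l; have y1s : y1 \in s by rewrite mem_cat y1l.
    exists (lollipop_loop stick petal (SeqSub y1s)); rewrite loop_cls.
    by split=> //; apply: walk_lollipop_loop.
have mem_tag k d : d \in lollipop_petal stick petal (jj k) ->
    tag d.1 = jj k /\ d.2 = false by apply: lollipop_petal_mem.
apply: (near_visibilityI st (stage_used_inj st nocut)).
- by move=> k; apply: lollipop_petal_uniq.
- move=> k k' d /mem_tag[dk _] /mem_tag[dk' _].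
  by apply: jj_inj; rewrite -dk -dk'.
- move=> k k' d /mem_tag[_ d2]; apply/negP => /mem_tag[_] /=.
  by rewrite d2.
Qed.
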